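(* Let $D$ be an open subset of $\mathcal{R}^{(2)}$ and let $f:D\to\mathcal{R}^{(2)}$ be given by $$f(x)=u(x_1,x_2)+v(x_1,x_2)\,1^{\#}\quad\text{for } x=x_1+x_2\,1^{\#}\in D,$$ where $u$ and $v$ are real-valued functions of the two real variables $x_1,x_2$. Let $c=c_1+c_2\,1^{\#}\in D$ with $c_1,c_2\in\mathcal{R}$. (i) If the first-order partial derivatives $u_{x_1},u_{x_2},v_{x_1},v_{x_2}$ exist at $(c_1,c_2)$ and are continuous at $(c_1,c_2)$, and the equations $$u_{x_1}=v_{x_2},\qquad u_{x_2}=0$$ hold at $(c_1,c_2)$, then $f$ is differentiable at $c$ and the derivative of $f$ at $c$ is $f'(c)=u_{x_1}(c)+v_{x_1}(c)\,1^{\#}$. (ii) If $f$ is differentiable at $c$, then the equations $u_{x_1}=v_{x_2}$ and $u_{x_2}=0$ hold at $c=c_1+c_2\,1^{\#}$. In this case, the derivative of $f$ at $c$ is $f'(c)=u_{x_1}(c)+v_{x_1}(c)\,1^{\#}$.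
   Context: Dual real numbers: $\mathcal{R}^{(2)}$ is the real vector space $\mathcal{R}^2$ (with $\mathcal{R}$ the field of real numbers) with the multiplication $(x_1,x_2)\cdot(y_1,y_2)=(x_1y_1,\,x_1y_2+x_2y_1)$. Write $1=(1,0)$, $1^{\#}=(0,1)$, so $x=(x_1,x_2)=x_1+x_2\,1^{\#}$, and put $Re\,x:=x_1$, $Ze\,x:=x_2$. The norm is $\|x\|:=\sqrt{2(Re\,x)^2+(Ze\,x)^2}$, and $\mathcal{R}^{(2)}$ carries the corresponding metric topology. For real $\delta>0$, $N(c;\delta)=\{x\in\mathcal{R}^{(2)}:\|x-c\|<\delta\}$ and $N^*(c;\delta)=N(c;\delta)\setminus\{c\}$. Differentiability: for $D\subseteq\mathcal{R}^{(2)}$ open and $c\in D$, a function $f:D\to\mathcal{R}^{(2)}$ is differentiable at $c$ with derivative $f'(c)\in\mathcal{R}^{(2)}$ if for each real $\epsilon>0$ there exists a real $\delta>0$ such that $N^*(c;\delta)\subseteq D$ and, for all $x\in N^*(c;\delta)$, $\frac{\|f(x)-f(c)-f'(c)(x-c)\|}{\|x-c\|}<\epsilon$, where $f'(c)$ does not depend on $\epsilon$ and $f'(c)(x-c)$ is the product in $\mathcal{R}^{(2)}$. A real function of $x$ is identified with a function of $(x_1,x_2)$, e.g. $u_{x_1}(c)=u_{x_1}(c_1,c_2)$; saying that an equation between partial derivatives holds at a point includes that those partial derivatives exist there. *)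

(* Defs.v *)
From HB Require Import structures.
From mathcomp Require Import all_boot all_order all_algebra ring lra.
From mathcomp Require Import all_classical all_reals all_analysis.

Set Implicit Arguments.
Unset Strict Implicit.
Unset Printing Implicit Defensive.

Import Order.TTheory GRing.Theory Num.Theory.
Import numFieldNormedType.Exports.

Local Open Scope classical_set_scope.
Local Open Scope ring_scope.

(* A record rather than an alias of R * R: the latter already carries the
   componentwise product and the sup norm, which are not the ones wanted. *)
Record dual (R : realType) : Type := Dual { dRe : R; dZe : R }.

Section DualNumbers.
Variable R : realType.
Implicit Types x y z : dual R.

Definition pair_of_dual x : R * R := (dRe x, dZe x).
Definition dual_of_pair (p : R * R) : dual R := Dual p.1 p.2.

Lemma pair_of_dualK : cancel pair_of_dual dual_of_pair.
Proof. by case. Qed.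

HB.instance Definition _ := Choice.copy (dual R) (can_type pair_of_dualK).

Definition dual_add x y := Dual (dRe x + dRe y) (dZe x + dZe y).
Definition dual_opp x := Dual (- dRe x) (- dZe x).
Definition dual_mul x y := Dual (dRe x * dRe y) (dRe x * dZe y + dZe x * dRe y).
Definition dual_scale (a : R) x := Dual (a * dRe x) (a * dZe x).

Lemma dual_addA : associative dual_add.
Proof. by move=> x y z; rewrite /dual_add /= !addrA. Qed.
Lemma dual_addC : commutative dual_add.
Proof. by move=> x y; congr Dual => /=; rewrite addrC. Qed.
Lemma dual_add0 : left_id (Dual 0 0) dual_add.
Proof. by case=> a b; rewrite /dual_add /= !add0r. Qed.
Lemma dual_addN : left_inverse (Dual 0 0) dual_opp dual_add.
Proof. by case=> a b; rewrite /dual_add /= !addNr. Qed.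

HB.instance Definition _ := GRing.isZmodule.Build (dual R)
  dual_addA dual_addC dual_add0 dual_addN.

Lemma dual_mulA : associative dual_mul.
Proof. by move=> x y z; congr Dual => /=; ring. Qed.
Lemma dual_mulC : commutative dual_mul.
Proof. by move=> x y; congr Dual => /=; ring. Qed.
Lemma dual_mul1 : left_id (Dual 1 0) dual_mul.
Proof. by case=> a b; congr Dual => /=; ring. Qed.
Lemma dual_mulD : left_distributive dual_mul +%R.
Proof. by move=> x y z; congr Dual => /=; ring. Qed.
Lemma dual_1neq0 : Dual 1 0 != 0 :> dual R.
Proof. by apply/eqP => -[/eqP]; rewrite oner_eq0. Qed.

HB.instance Definition _ := GRing.Zmodule_isComNzRing.Build (dual R)
  dual_mulA dual_mulC dual_mul1 dual_mulD dual_1neq0.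

Lemma dual_scaleA a b x :
  dual_scale a (dual_scale b x) = dual_scale (a * b) x.
Proof. by congr Dual => /=; ring. Qed.
Lemma dual_scale1 : left_id 1 dual_scale.
Proof. by case=> a b; congr Dual => /=; ring. Qed.
Lemma dual_scaleDr : right_distributive dual_scale +%R.
Proof. by move=> a x y; congr Dual => /=; ring. Qed.
Lemma dual_scaleDl x : {morph dual_scale^~ x : a b / a + b}.
Proof. by move=> a b; congr Dual => /=; ring. Qed.

HB.instance Definition _ := GRing.Zmodule_isLmodule.Build R (dual R)
  dual_scaleA dual_scale1 dual_scaleDr dual_scaleDl.

Lemma dual_scaleAl (a : R) x y : a *: (x * y) = a *: x * y.
Proof. by congr Dual => /=; ring. Qed.

HB.instance Definition _ := GRing.Lmodule_isLalgebra.Build R (dual R)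
  dual_scaleAl.
HB.instance Definition _ := GRing.Lalgebra_isComAlgebra.Build R (dual R).

Definition dual_norm x : R := Num.sqrt (2 * dRe x ^+ 2 + dZe x ^+ 2).

Lemma dual_sq_ge0 x : 0 <= 2 * dRe x ^+ 2 + dZe x ^+ 2.
Proof. by rewrite addr_ge0 ?sqr_ge0 // mulr_ge0 ?sqr_ge0. Qed.

Lemma dual_norm_ge0 x : 0 <= dual_norm x.
Proof. exact: sqrtr_ge0. Qed.

Lemma dual_norm_sq x : dual_norm x ^+ 2 = 2 * dRe x ^+ 2 + dZe x ^+ 2.
Proof. exact/sqr_sqrtr/dual_sq_ge0. Qed.

Lemma dual_normD x y : dual_norm (x + y) <= dual_norm x + dual_norm y.
Proof.
have nx := dual_norm_ge0 x; have ny := dual_norm_ge0 y.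
rewrite -(@ler_pXn2r _ 2) ?nnegrE ?addr_ge0 ?dual_norm_ge0 //.
have CS : 2 * dRe x * dRe y + dZe x * dZe y <= dual_norm x * dual_norm y.
  apply: (le_trans (ler_norm _)).
  rewrite -(@ler_pXn2r _ 2) ?nnegrE ?mulr_ge0 // real_normK ?num_real //.
  rewrite exprMn !dual_norm_sq -subr_ge0.
  have -> : (2 * dRe x ^+ 2 + dZe x ^+ 2) * (2 * dRe y ^+ 2 + dZe y ^+ 2)
      - (2 * dRe x * dRe y + dZe x * dZe y) ^+ 2
    = 2 * (dRe x * dZe y - dZe x * dRe y) ^+ 2 by ring.
  by rewrite mulr_ge0 ?sqr_ge0.
rewrite sqrrD !dual_norm_sq /=.
move: CS; set P := dual_norm x * dual_norm y => CS.
by rewrite mulr2n; lra.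
Qed.

Lemma dual_normZ (a : R) x : dual_norm (a *: x) = `|a| * dual_norm x.
Proof.
rewrite /dual_norm /= -sqrtr_sqr -sqrtrM ?sqr_ge0 //.
by congr Num.sqrt; ring.
Qed.

Lemma dual_norm0_eq0 x : dual_norm x = 0 -> x = 0.
Proof.
move=> nx0; have := dual_norm_sq x; rewrite nx0 expr0n /= => /esym/eqP.
have re0 : 0 <= 2 * dRe x ^+ 2 by apply: mulr_ge0; rewrite ?sqr_ge0.
rewrite (paddr_eq0 re0 (sqr_ge0 _)) mulf_eq0 pnatr_eq0 /= !sqrf_eq0.
by case: x {nx0 re0} => a b /= /andP[/eqP-> /eqP->].
Qed.

HB.instance Definition _ := Lmodule_isNormed.Build R (dual R)
  dual_normD dual_normZ dual_norm0_eq0.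

Definition dual_sharp : dual R := Dual 0 1.

End DualNumbers.

Notation "1^#" := (dual_sharp _) (at level 0, format "1^#") : ring_scope.

Section Differentiability.
Variable R : realType.
Implicit Types (D : set (dual R)) (f : dual R -> dual R) (c l : dual R).

Lemma dualE (x : dual R) : x = (dRe x)%:A + dZe x *: 1^#.
Proof. by case: x => a b; congr Dual => /=; ring. Qed.

Lemma dual_normE (x : dual R) : `|x| = Num.sqrt (2 * dRe x ^+ 2 + dZe x ^+ 2).
Proof. by []. Qed.

Definition deleted_ball c (delta : R) : set (dual R) :=
  [set x | `|x - c| < delta] `\ c.

(* f is total, but deleted_ball c delta `<=` D makes only its values on D matter
   (when c itself lies in D). *)
Definition is_dual_derive D f c l :=
  forall eps : R, 0 < eps -> exists2 delta : R, 0 < delta &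
    deleted_ball c delta `<=` D /\
    forall x, deleted_ball c delta x ->
      `|f x - f c - l * (x - c)| / `|x - c| < eps.

Definition dual_differentiable D f c := exists l, is_dual_derive D f c l.

Lemma is_dual_derive_unique D f c l l' :
  is_dual_derive D f c l -> is_dual_derive D f c l' -> l = l'.
Proof.
move=> dl dl'; apply/eqP; rewrite -subr_eq0 -normr_eq0 eq_le normr_ge0 andbT.
apply/ler_addgt0Pr => e e0; rewrite add0r.
have n1 : 0 < `|1 : dual R| by rewrite normr_gt0 oner_neq0.
set n := `|1 : dual R| in n1 *.
have e20 : 0 < e / (2 * n) by rewrite divr_gt0 ?mulr_gt0.
have [d d0 [_ Hd]] := dl _ e20; have [d' d'0 [_ Hd']] := dl' _ e20.
have m0 : 0 < Num.min d d' by rewrite lt_min d0 d'0.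
pose t := Num.min d d' / (2 * n).
have t0 : 0 < t by rewrite divr_gt0 ?mulr_gt0.
pose x : dual R := c + t%:A.
have xc : x - c = t%:A by rewrite /x addrC addKr.
have nxc : `|x - c| = t * n by rewrite xc normrZ gtr0_norm.
have nx0 : 0 < `|x - c| by rewrite nxc mulr_gt0.
have xlt : `|x - c| < Num.min d d'.
  rewrite nxc (_ : t * n = Num.min d d' / 2) ?ltr_pdivrMr ?ltr_pMr ?ltr1n //.
  by rewrite /t; field; rewrite gt_eqF.
have xNc : x <> c by move/eqP; rewrite -subr_eq0 -normr_eq0 gt_eqF.
move: xlt; rewrite lt_min => /andP[xd xd'].
have := Hd x (conj xd xNc); rewrite ltr_pdivrMr // => A.
have := Hd' x (conj xd' xNc); rewrite ltr_pdivrMr // => B.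
have E : t *: (l - l') =
  (f x - f c - l' * (x - c)) - (f x - f c - l * (x - c)).
  have -> : t *: (l - l') = (l - l') * (x - c) by rewrite xc -scalerAr mulr1.
  by ring.
have := ler_normB (f x - f c - l' * (x - c)) (f x - f c - l * (x - c)).
rewrite -E normrZ (gtr0_norm t0) => C.
rewrite -(ler_pM2l t0); apply: (le_trans C); apply/ltW.
apply: (lt_le_trans (ltrD B A)).
rewrite nxc le_eqVlt; apply/orP; left; apply/eqP; field.
by rewrite gt_eqF.
Qed.

End Differentiability.

Section PartialDerivatives.
Variable R : realType.
Implicit Types (u : R -> R -> R) (p : R * R).

Definition has_pderiv1 u p := derivable (fun t => u t p.2) p.1 1.
Definition has_pderiv2 u p := derivable (fun t => u p.1 t) p.2 1.
Definition pderiv1 u p : R := derive1 (fun t => u t p.2) p.1.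
Definition pderiv2 u p : R := derive1 (fun t => u p.1 t) p.2.

End PartialDerivatives.

(* Main.v *)
Require Import Defs.
From mathcomp Require Import all_boot all_order all_algebra.
From mathcomp Require Import all_classical all_reals all_analysis.
From mathcomp Require Import ring lra.

Import Order.TTheory GRing.Theory Num.Theory.
Import numFieldNormedType.Exports.

Local Open Scope classical_set_scope.
Local Open Scope ring_scope.

(** Multiplication by [l] is the real linear map
    [(h, k) |-> (Re l * h, Ze l * h + Re l * k)], so differentiability at [c]
    with derivative [l] means that [u] and [v] are totally differentiable at
    [c] with gradients [(Re l, 0)] and [(Ze l, Re l)]. Read along the
    coordinate axes this gives (ii). For (i), total differentiability of [u]
    and [v] follows from the mean value theorem in the first variable,
    continuity of the first partial derivative, and mere existence of the
    second one. *)

(** Multiplying the error of the difference quotient by [|h|] clears the division. The weak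
    inequality is trivial at [x = a], so no punctured neighbourhood is needed and the bound compares
    directly with [has_gradient]. *)
Lemma is_derive_littleoP (R : realType) (g : R -> R) (a l : R) :
  is_derive a 1 g l <->
  (forall eps, 0 < eps -> exists2 d, 0 < d &
     forall x, `|x - a| < d -> `|g x - g a - l * (x - a)| <= eps * `|x - a|).
Proof.
have quotE h : h != 0 ->
    `|l - h^-1 *: ((g \o shift a) (h *: (1 : R)) - g a)| * `|h|
    = `|g (a + h) - g a - l * h|.
  move=> h0; rewrite -normrM distrC /= /GRing.scale /= mulr1 (addrC h).
  by congr `|_|; field.
split=> [[/cvg_ex[/= l' gl'] gl] eps e0|H].
  have l'E : l' = l by rewrite -gl; apply/esym/cvg_lim.
  rewrite {}l'E in gl'; move/cvgrPdist_le/(_ _ e0) : gl'.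
  move=> /nbhs_ballP[d /= d0 dP]; exists d => // x xd.
  have [->|xa] := eqVneq x a; first by rewrite !subrr mulr0 subrr normr0 mulr0.
  have h0 : x - a != 0 by rewrite subr_eq0.
  have := quotE _ h0; rewrite (addrC a) subrK => <-.
  by rewrite ler_wpM2r //; apply: dP => //=; rewrite /ball /= sub0r normrN.
have cvl : (h^-1 *: ((g \o shift a) (h *: (1 : R)) - g a) @[h --> 0^'])
    --> (l : R).
  apply/cvgrPdist_le => eps e0; have [d d0 dP] := H _ e0.
  apply/nbhs_ballP; exists d => //= h; rewrite /ball /= sub0r normrN => hd h0.
  rewrite -(ler_pM2r (x := `|h|)) ?normr_gt0// quotE//.
  by have := dP (a + h); rewrite (addrC a) addrK; exact.
by split; [apply/cvg_ex; exists l | exact/cvg_lim].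
Qed.

(** The interval symmetric about [a] contains the segment to [b] on either side, so applications
    need not know the sign of [b - a]. *)
Lemma MVT_unordered (R : realType) (g : R -> R) (a b : R) :
  (forall t, `|t - a| <= `|b - a| -> derivable g t 1) ->
  exists2 t, `|t - a| <= `|b - a| & g b - g a = derive1 g t * (b - a).
Proof.
move=> dg; have main x y : x <= y ->
    (forall t, x <= t <= y -> derivable g t 1) ->
    exists2 t, x <= t <= y & g y - g x = derive1 g t * (y - x).
  move=> xy dxy; have [||t] := @MVT_segment _ g (derive1 g) x y xy.
  - move=> t; rewrite in_itv /= => /andP[xt ty].
    by rewrite derive1E; apply/derivableP/dxy; rewrite !ltW.
  - by apply: derivable_within_continuous => t; rewrite in_itv /= => /dxy.
  - by rewrite in_itv /= => xty E; exists t.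
have [ab|/ltW ba] := leP a b.
  have [|t tab E] := main _ _ ab.
    by move=> t tab; apply: dg; rewrite !ger0_norm; lra.
  by exists t => //; rewrite !ger0_norm; lra.
have [|t tab E] := main _ _ ba.
  by move=> t tab; apply: dg; rewrite !ler0_norm; lra.
exists t; first by rewrite !ler0_norm; lra.
by rewrite -opprB E -mulrN opprB.
Qed.

(** Total differentiability at [p], on square neighbourhoods and with the sum norm in the error.
    Norms on the plane being equivalent, this choice keeps the two coordinates separate. *)
Definition has_gradient {R : realType} (w : R -> R -> R) (p : R * R) (a b : R) :=
  forall eps, 0 < eps -> exists2 d, 0 < d &
    forall x1 x2, `|x1 - p.1| < d -> `|x2 - p.2| < d ->
      `|w x1 x2 - w p.1 p.2 - (a * (x1 - p.1) + b * (x2 - p.2))|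
      <= eps * (`|x1 - p.1| + `|x2 - p.2|).

Section Gradient.
Variable R : realType.
Implicit Types (w : R -> R -> R) (a b : R) (p : R * R).

Lemma has_gradient_is_derive w p a b : has_gradient w p a b ->
  is_derive p.1 1 (fun t => w t p.2) a /\ is_derive p.2 1 (fun t => w p.1 t) b.
Proof.
move=> wab; split; apply/is_derive_littleoP => eps /wab[d d0 dP];
  exists d => // t td.
- by have := dP t p.2 td; rewrite subrr normr0 mulr0 !addr0; exact.
- by have := dP p.1 t; rewrite subrr normr0 mulr0 !add0r; exact.
Qed.

(** Go from [(c1, c2)] vertically to [(c1, x2)], where the derivative at [c2] controls the
    increment, then horizontally to [(x1, x2)], where the mean value theorem gives
    [pderiv1 w (t, x2)], close to its value at [p] by continuity. *)
Lemma continuous_pderiv1_gradient w p :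
  (\forall q \near p, has_pderiv1 w q) -> has_pderiv2 w p ->
  {for p, continuous (pderiv1 w)} ->
  has_gradient w p (pderiv1 w p) (pderiv2 w p).
Proof.
case: p => c1 c2 /nbhs_ballP[d1 /= d10 ex1] ex2 ct eps e0.
move/cvgrPdist_le/(_ _ e0)/nbhs_ballP : ct => [d2 /= d20 near1].
have der2 : is_derive c2 1 (w c1) (pderiv2 w (c1, c2)).
  by rewrite /pderiv2 derive1E; exact/derivableP.
have [d3 d30 near2] := (is_derive_littleoP _ _ _ _).1 der2 _ e0.
(* [d1] ensures that the first partial exists, [d2] that it varies by at most [eps], and [d3]
   controls the vertical increment. *)
exists (Num.min d1 (Num.min d2 d3)); first by rewrite !lt_min d10 d20.
move=> x1 x2; rewrite !lt_min => /and3P[x1d1 x1d2 x1d3] /and3P[x2d1 x2d2 x2d3].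
have [t tx1|t tx1 wE] := @MVT_unordered _ (w ^~ x2) c1 x1.
  apply: (ex1 (t, x2)); split; rewrite /ball /= distrC //.
  exact: le_lt_trans x1d1.
have {}near1 : `|pderiv1 w (c1, c2) - pderiv1 w (t, x2)| <= eps.
  apply: near1; split; rewrite /ball /= distrC //.
  exact: le_lt_trans x1d2.
have {}near2 := near2 _ x2d3.
rewrite /= (_ : _ - _ - _ =
    (pderiv1 w (t, x2) - pderiv1 w (c1, c2)) * (x1 - c1) +
    (w c1 x2 - w c1 c2 - pderiv2 w (c1, c2) * (x2 - c2))); last first.
  by rewrite mulrBl /pderiv1 /= -wE /=; ring.
rewrite [leRHS]mulrDr (le_trans (ler_normD _ _)) // lerD // normrM distrC.
by rewrite ler_wpM2r.
Qed.

End Gradient.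

Section DualDerivative.
Variable R : realType.
Implicit Types (x c l : dual R) (f : dual R -> dual R) (D : set (dual R)).

Lemma dual_coordE (a b : R) : a%:A + b *: 1^# = Dual a b.
Proof. by rewrite [RHS]dualE. Qed.

Lemma normr_dRe_le x : `|dRe x| <= `|x|.
Proof.
rewrite -(@ler_pXn2r _ 2) ?nnegrE // real_normK ?num_real // dual_norm_sq.
have := sqr_ge0 (dRe x); have := sqr_ge0 (dZe x); lra.
Qed.

Lemma normr_dZe_le x : `|dZe x| <= `|x|.
Proof.
rewrite -(@ler_pXn2r _ 2) ?nnegrE // real_normK ?num_real // dual_norm_sq.
have := sqr_ge0 (dRe x); lra.
Qed.

(** The coefficient 2 is a convenient upper bound for the square root of 2; the square of the right
    side exceeds that of the left by nonnegative terms. *)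
Lemma dual_norm_le x : `|x| <= 2 * `|dRe x| + `|dZe x|.
Proof.
have a0 := normr_ge0 (dRe x); have b0 := normr_ge0 (dZe x).
rewrite -(@ler_pXn2r _ 2) ?nnegrE ?addr_ge0 ?mulr_ge0 // dual_norm_sq.
rewrite -(real_normK (num_real (dRe x))) -(real_normK (num_real (dZe x))).
have := mulr_ge0 a0 b0; have := sqr_ge0 `|dRe x|.
set a := `|dRe x|; set b := `|dZe x|; nra.
Qed.

Lemma is_dual_derive_littleoP D f c l : D c ->
  is_dual_derive D f c l <->
  (forall eps, 0 < eps -> exists2 d, 0 < d & forall x, `|x - c| < d ->
     D x /\ `|f x - f c - l * (x - c)| <= eps * `|x - c|).
Proof.
move=> Dc; split=> H eps e0.
  have [d d0 [dD dP]] := H _ e0; exists d => // x xd.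
  have [->|/eqP xc] := eqVneq x c.
    by rewrite !subrr mulr0 subrr normr0 mulr0.
  split; first exact: dD.
  by rewrite -ler_pdivrMr ?normr_gt0 ?subr_eq0; [exact/ltW/dP | exact/eqP].
(* Halving [eps] turns the weak bound into the strict one. *)
have e20 : 0 < eps / 2 by lra.
have [d d0 dP] := H _ e20; exists d => //; split=> [x [/dP[]//]|x [xd /eqP xc]].
have n0 : 0 < `|x - c| by rewrite normr_gt0 subr_eq0.
rewrite ltr_pdivrMr //; apply: le_lt_trans (dP _ xd).2 _.
by rewrite ltr_pM2r //; lra.
Qed.

Lemma is_dual_derive_gradientP D f (u v : R -> R -> R) c l : D c -> open D ->
  (forall x, D x -> f x = Dual (u (dRe x) (dZe x)) (v (dRe x) (dZe x))) ->
  is_dual_derive D f c l <->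
  has_gradient u (dRe c, dZe c) (dRe l) 0 /\
  has_gradient v (dRe c, dZe c) (dZe l) (dRe l).
Proof.
move=> Dc oD fE; rewrite is_dual_derive_littleoP //.
(* The coordinates of the error of [f] are the errors of [u] and [v] against the gradients
   [(dRe l, 0)] and [(dZe l, dRe l)]. *)
have incrE x : D x -> f x - f c - l * (x - c) = Dual
    (u (dRe x) (dZe x) - u (dRe c) (dZe c)
      - (dRe l * (dRe x - dRe c) + 0 * (dZe x - dZe c)))
    (v (dRe x) (dZe x) - v (dRe c) (dZe c)
      - (dZe l * (dRe x - dRe c) + dRe l * (dZe x - dZe c))).
  by move=> Dx; rewrite !fE //; congr Dual => /=; ring.
split=> [H|[Hu Hv] eps e0].
  (* One bound on the whole error serves both gradients, since each coordinate is at most the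
     norm. *)
  suff H2 eps : 0 < eps -> exists2 d, 0 < d & forall x1 x2 : R,
      `|x1 - dRe c| < d -> `|x2 - dZe c| < d ->
      let x := Dual x1 x2 in D x /\ `|f x - f c - l * (x - c)|
        <= eps * (`|x1 - dRe c| + `|x2 - dZe c|).
    split=> eps /H2[d d0 dP]; exists d => // x1 x2 x1d x2d /=;
      have [/incrE E] := dP _ _ x1d x2d; apply: le_trans; rewrite E.
    - exact: le_trans (normr_dRe_le _).
    - exact: le_trans (normr_dZe_le _).
  (* By [dual_norm_le], coordinate increments below [d / 3] give a norm below [d], and the norm is
     at most twice their sum, whence [eps / 2]. *)
  move=> e0; have e20 : 0 < eps / 2 by lra.
  have [d d0 dP] := H _ e20; exists (d / 3); first by lra.
  move=> x1 x2 x1d x2d x.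
  have /= xc := dual_norm_le (x - c).
  have [|Dx le] := dP x; first by apply: le_lt_trans xc _; lra.
  split=> //; apply: le_trans le _.
  rewrite -mulrA ler_pM2l //.
  by have := normr_ge0 (x2 - dZe c); lra.
(* The error is at most 2 + 1 times [eps / 8] times the sum of the coordinate increments, and this
   sum is at most twice the norm: in all 6/8 of the allowed bound. *)
have e80 : 0 < eps / 8 by lra.
have /nbhs_normP[d1 /= d10 d1P] := open_nbhs_nbhs (conj oD Dc).
have [d2 d20 d2P] := Hu _ e80; have [d3 d30 d3P] := Hv _ e80.
exists (Num.min d1 (Num.min d2 d3)); first by rewrite !lt_min d10 d20.
move=> x; rewrite !lt_min => /and3P[xd1 xd2 xd3].
have Dx : D x by apply: d1P; rewrite /= distrC.
split=> //; rewrite incrE //; apply: le_trans (dual_norm_le _) _ => /=.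
have := normr_dRe_le (x - c); have := normr_dZe_le (x - c).
move=> /= zc rc.
have := d2P _ _ (le_lt_trans rc xd2) (le_lt_trans zc xd2).
have := d3P _ _ (le_lt_trans rc xd3) (le_lt_trans zc xd3).
move=> /= le3 le2; have := ler_wpM2l (ltW e80) (lerD rc zc).
have := mulr_ge0 (ltW e0) (normr_ge0 (x - c)); lra.
Qed.

End DualDerivative.

Theorem proposition2p1 (R : realType) (D : set (dual R)) (D_open : open D)
    (f : dual R -> dual R) (u v : R -> R -> R)
    (f_uv : forall x1 x2 : R, D (x1%:A + x2 *: 1^#) ->
       f (x1%:A + x2 *: 1^#) = (u x1 x2)%:A + v x1 x2 *: 1^#)
    (c : dual R) (c1 c2 : R) (c_eq : c = c1%:A + c2 *: 1^#) (cD : D c) :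
  ((\forall p \near (c1, c2), has_pderiv1 u p) ->
   (\forall p \near (c1, c2), has_pderiv2 u p) ->
   (\forall p \near (c1, c2), has_pderiv1 v p) ->
   (\forall p \near (c1, c2), has_pderiv2 v p) ->
   {for (c1, c2), continuous (pderiv1 u)} ->
   {for (c1, c2), continuous (pderiv2 u)} ->
   {for (c1, c2), continuous (pderiv1 v)} ->
   {for (c1, c2), continuous (pderiv2 v)} ->
   pderiv1 u (c1, c2) = pderiv2 v (c1, c2) ->
   pderiv2 u (c1, c2) = 0 ->
   is_dual_derive D f c
     ((pderiv1 u (c1, c2))%:A + pderiv1 v (c1, c2) *: 1^#))
  /\
  (dual_differentiable D f c ->
   [/\ has_pderiv1 u (c1, c2) /\ has_pderiv2 u (c1, c2),
       has_pderiv1 v (c1, c2) /\ has_pderiv2 v (c1, c2),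
       pderiv1 u (c1, c2) = pderiv2 v (c1, c2),
       pderiv2 u (c1, c2) = 0 &
       is_dual_derive D f c
         ((pderiv1 u (c1, c2))%:A + pderiv1 v (c1, c2) *: 1^#)]).
Proof.
have fE x : D x -> f x = Dual (u (dRe x) (dZe x)) (v (dRe x) (dZe x)).
  by move=> Dx; rewrite -dual_coordE -f_uv -?dualE.
rewrite dual_coordE in c_eq; rewrite !dual_coordE.
have derP l : is_dual_derive D f c l <->
    has_gradient u (c1, c2) (dRe l) 0 /\ has_gradient v (c1, c2) (dZe l) (dRe l).
  by rewrite (is_dual_derive_gradientP _ _ _ _ _ _ _ cD D_open fE) c_eq.
split=> [u1 u2 v1 v2 cu1 _ cv1 _ u1v2 u20|[l fl]].
  (* The two equations turn the required second components [0] and [pderiv1 u] into [pderiv2 u] and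
     [pderiv2 v]. *)
  apply/derP => /=; split; first rewrite -u20; last rewrite u1v2.
  - by apply: continuous_pderiv1_gradient => //; exact: nbhs_singleton u2.
  - by apply: continuous_pderiv1_gradient => //; exact: nbhs_singleton v2.
(* The four partials are [dRe l], [0], [dZe l], [dRe l]: the first and last agree, and the first and
   third reassemble [l]. *)
have [/has_gradient_is_derive[/= u1 u2] /has_gradient_is_derive[/= v1 v2]] :=
  (derP l).1 fl.
have pu1 : pderiv1 u (c1, c2) = dRe l by rewrite /pderiv1 derive1E; case: u1.
have pu2 : pderiv2 u (c1, c2) = 0 by rewrite /pderiv2 derive1E; case: u2.
have pv1 : pderiv1 v (c1, c2) = dZe l by rewrite /pderiv1 derive1E; case: v1.
have pv2 : pderiv2 v (c1, c2) = dRe l by rewrite /pderiv2 derive1E; case: v2.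
split=> //; [by split; [case: u1|case: u2] | by split; [case: v1|case: v2]| |].
- by rewrite pu1.
- by rewrite pu1 pv1; case: l fl {u1 u2 v1 v2 pu1 pu2 pv1 pv2}.
Qed.
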